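(* Let $\varphi\in\mathcal C$ and let $i\in\{1,\dots,n-1\}$. There exists no constant $c>0$ such that $$c\,R_i(K+_\varphi K')\ \le\ R_i(K)+R_i(K')$$ holds for all $K,K'\in\mathcal K^n_o$.
   Context: $\mathcal C$ is the class of convex, strictly increasing functions $\varphi:[0,\infty)\to[0,\infty)$ with $\varphi(0)=0$ and $\varphi(1)=1$. A convex body in $\mathbb R^n$ is a compact convex subset with nonempty interior; $\mathcal K^n_o$ is the class of convex bodies in $\mathbb R^n$ containing the origin. The support function of $K$ is $h_K(x)=\max_{y\in K}\langle x,y\rangle$. For $\varphi\in\mathcal C$ and $K,L\in\mathcal K^n_o$, the Orlicz Minkowski sum $K+_\varphi L$ is the convex body with support function $$h_{K+_\varphi L}(x)=\inf\{\lambda>0:\varphi(h_K(x)/\lambda)+\varphi(h_L(x)/\lambda)\le 1\}.$$ $\mathcal L^n_i$ is the set of $i$-dimensional linear subspaces of $\mathbb R^n$, $K|L$ is the orthogonal projection of $K$ onto $L$, and $R(\cdot)$ is the circumradius. For $i=1,\dots,n$ the successive outer radius is $R_i(K)=\min_{L\in\mathcal L^n_i}R(K|L)$. *)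

(* Defs.v *)
From HB Require Import structures.
From mathcomp Require Import all_boot all_order all_algebra.
From mathcomp Require Import all_classical all_reals all_analysis.

Set Implicit Arguments.
Unset Strict Implicit.
Unset Printing Implicit Defensive.

Import Order.TTheory GRing.Theory Num.Theory.
Import numFieldNormedType.Exports.

Local Open Scope classical_set_scope.
Local Open Scope ring_scope.

(* Only the values of phi on [0, +oo[ matter. *)
Definition orlicz_class (R : realType) (phi : R -> R) : Prop :=
  [/\ forall t : R, 0 <= t -> 0 <= phi t,
      convex_function (`[0, +oo[%classic : set R^o) phi,
      {in `[0, +oo[ &, {homo phi : s t / s < t}},
      phi 0 = 0 & phi 1 = 1].

Definition dot (R : realType) (n : nat) (x y : 'rV[R]_n) : R :=
  \sum_(k < n) x ord0 k * y ord0 k.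

(* The library norm on row vectors is the sup norm, hence this one; both induce
   the same topology. *)
Definition euclidean_norm (R : realType) (n : nat) (x : 'rV[R]_n) : R :=
  Num.sqrt (dot x x).

Definition convex_body (R : realType) (n : nat) (K : set 'rV[R]_n) : Prop :=
  [/\ convex_set K, compact K & K° !=set0].

Definition convex_body_o (R : realType) (n : nat) (K : set 'rV[R]_n) : Prop :=
  convex_body K /\ K 0.

Definition support_function (R : realType) (n : nat) (K : set 'rV[R]_n)
    (x : 'rV[R]_n) : R :=
  sup [set dot x y | y in K].

Definition orlicz_support (R : realType) (n : nat) (phi : R -> R)
    (K L : set 'rV[R]_n) (x : 'rV[R]_n) : R :=
  inf [set lambda : R | 0 < lambda /\
    phi (support_function K x / lambda) +
    phi (support_function L x / lambda) <= 1].

(* A convex body is determined by its support function, so at most one M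
   qualifies. For phi in the class C and bodies K, L containing the origin
   there is one; the default set0 is only used outside that situation. *)
Definition orlicz_sum (R : realType) (n : nat) (phi : R -> R)
    (K L : set 'rV[R]_n) : set 'rV[R]_n :=
  xget set0 [set M | convex_body M /\
    support_function M = orlicz_support phi K L].

Definition orthogonal_projection (R : realType) (n : nat)
    (K : set 'rV[R]_n) (L : {vspace 'rV[R]_n}) : set 'rV[R]_n :=
  [set y | y \in L /\
    exists2 x, K x & forall z, z \in L -> dot (x - y) z = 0].

Definition circumradius (R : realType) (n : nat) (A : set 'rV[R]_n) : R :=
  inf [set r : R | 0 <= r /\
    exists p : 'rV[R]_n, forall x, A x -> euclidean_norm (x - p) <= r].

(* The minimum over L is attained, so that it equals the infimum below; likewise
   for the maximum defining the support function. *)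
Definition outer_radius (R : realType) (n i : nat) (K : set 'rV[R]_n) : R :=
  inf [set r : R | exists2 L : {vspace 'rV[R]_n}, \dim L = i &
    r = circumradius (orthogonal_projection K L)].

(* Main.v *)
Require Import Defs.
From HB Require Import structures.
From mathcomp Require Import all_boot all_order all_algebra.
From mathcomp Require Import all_classical all_reals all_analysis.
From mathcomp Require Import ring lra zify.

Import Order.TTheory GRing.Theory Num.Theory.
Import numFieldNormedType.Exports.

Local Open Scope classical_set_scope.
Local Open Scope ring_scope.

(** The inequality can only hold if a body that is thin in many directions
stays thin under the sum.  It does not: fix a small e > 0 and a set J of i
coordinates, and consider the box that has half-width e in the coordinates of J
and half-width 1 in the others.  Its projection onto the i-dimensional
coordinate subspace of J is a cube of side 2e, so its outer radius of order i is
O(e).  Because 1 <= i <= n - 1, a coordinate of J can be exchanged for one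
outside J, which gives a second set J' of i coordinates with #|J :&: J'| < i,
and the box of J' also has outer radius O(e).

Since phi 1 = 1 and phi is increasing, the support function of the Orlicz sum M
dominates those of both boxes, so that M extends by at least 1 in every
coordinate direction outside J :&: J'.  An i-dimensional subspace L always
contains a nonzero u whose coordinates in J :&: J' vanish, by dimension
counting, and the width of M in the direction u is also the width of its
projection onto L.  This bounds the circumradius of every such projection below
by 1/n, independently of e ([outer_radius_ge_coord]).  Letting e tend to 0
excludes every constant c.

What has to be established first is that the Orlicz sum exists, that is, that
its defining infimum is the support function of some body ([orlicz_sumP]).  The
infimum is H(h_K, h_L), where H(A, B) is the least lambda with
phi (A / lambda) + phi (B / lambda) <= 1.  This H is a supremum of linear
functions a A + b B with a, b >= 0, attained at each point
([orlicz_gauge_dual]).  At a point where A, B > 0, the coefficients are the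
components of the normal to the level curve phi s + phi t = 1 at the point
proportional to (A, B), which a subgradient of phi in each variable provides.
If x in K and y in L maximize the linear form u, then a x + b y lies in the
Wulff shape of H(h_K, h_L) and attains its bound in the direction u.  This is a
two-dimensional substitute for a separation theorem in dimension n. *)

(** * Functions of the class C and the planar gauge that they define *)

(** A Luxemburg-type norm on the quadrant [A, B >= 0]: the support function of
the Orlicz sum is this gauge of the two support functions. *)
Definition orlicz_gauge {R : realType} (phi : R -> R) (A B : R) : R :=
  inf [set lambda : R | 0 < lambda /\ phi (A / lambda) + phi (B / lambda) <= 1].

Section OrliczFunction.
Context {R : realType} {phi : R -> R}.
Hypothesis hphi : orlicz_class phi.

Lemma orlicz_ge0 (t : R) : 0 <= t -> 0 <= phi t.
Proof. by case: hphi => h _ _ _ _; exact: h. Qed.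

Lemma orlicz0 : phi 0 = 0. Proof. by case: hphi. Qed.

Lemma orlicz1 : phi 1 = 1. Proof. by case: hphi. Qed.

Lemma orlicz_lt (s t : R) : 0 <= s -> s < t -> phi s < phi t.
Proof.
case: hphi => _ _ h _ _ s0 st.
by apply: h => //; rewrite in_itv/= andbT // (le_trans s0 (ltW st)).
Qed.

Lemma orlicz_le (s t : R) : 0 <= s -> s <= t -> phi s <= phi t.
Proof.
by move=> s0; rewrite le_eqVlt => /predU1P[->//|/(orlicz_lt _ _ s0)/ltW].
Qed.

(** Convexity as monotonicity of slopes, with the denominators cleared. *)
Lemma orlicz_chord (x y z : R) : 0 <= x -> x < y -> y < z ->
  (phi y - phi x) * (z - y) <= (phi z - phi y) * (y - x).
Proof.
case: hphi => _ hc _ _ _ x0 xy yz.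
have zx : 0 < z - x by lra.
have t0 : 0 <= (z - y) / (z - x) by rewrite divr_ge0//; lra.
have t1 : (z - y) / (z - x) <= 1 by rewrite ler_pdivrMr//; lra.
have h := hc (Itv01 t0 t1) x z.
have := h _ _; rewrite !inE/= !in_itv/= !andbT => /(_ x0 ltac:(lra)).
rewrite convRE /conv/= /unstable.onem.
have -> : ((z - y) / (z - x)) *: (x : R^o) + (1 - (z - y) / (z - x)) *: (z : R^o) = y.
  by rewrite /GRing.scale/=; field; rewrite gt_eqF.
move=> hy; have {}hy : phi y * (z - x) <= phi x * (z - y) + phi z * (y - x) :> R.
  rewrite -ler_pdivlMr//; apply: le_trans hy _.
  rewrite le_eqVlt; apply/orP; left; apply/eqP.
  by field; rewrite gt_eqF.
by nra.
Qed.

(** The slope of a convex function on [[s, t]] is at most its slope on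
[[t, 2]], whose length is at least 1.  The point 2 gives the room beyond 1 that
keeps this bound finite up to the right end. *)
Lemma orlicz_lipschitz (s t : R) : 0 <= s -> s <= t -> t <= 1 ->
  phi t - phi s <= phi 2 * (t - s).
Proof.
move=> s0; rewrite le_eqVlt => /predU1P[->|st] t1; first by rewrite !subrr mulr0.
have c := orlicz_chord s t 2 s0 st ltac:(lra).
have := orlicz_lt _ _ s0 st; have := orlicz_ge0 t ltac:(lra) => pt st'.
nra.
Qed.

Lemma orlicz_le_id (t : R) : 0 <= t <= 1 -> phi t <= t.
Proof.
case/andP; rewrite le_eqVlt => /predU1P[<-|t0]; first by rewrite orlicz0.
rewrite le_eqVlt => /predU1P[->|t1]; first by rewrite orlicz1.
have := orlicz_chord 0 t 1 (lexx _) t0 t1; rewrite orlicz0 orlicz1; nra.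
Qed.

Lemma orlicz_le1 (t : R) : 0 <= t -> phi t <= 1 -> t <= 1.
Proof.
move=> t0 h; rewrite leNgt; apply/negP => t1.
by have := orlicz_lt _ _ ler01 t1; rewrite orlicz1 ltNge h.
Qed.

(** The supremum of the slopes of chords ending at [s]; slopes of chords
starting at [s] bound it from above. *)
Lemma orlicz_subgradient (s : R) : 0 < s ->
  exists2 p : R, 0 < p & forall t, 0 <= t -> phi s + p * (t - s) <= phi t.
Proof.
move=> s0.
pose S := [set q : R | exists2 u, 0 <= u < s & q = (phi s - phi u) / (s - u)].
have ubS z : s < z -> ubound S ((phi z - phi s) / (z - s)).
  move=> sz _ [u /andP[u0 us] ->].
  by rewrite ler_pdivrMr ?subr_gt0// mulrAC ler_pdivlMr ?subr_gt0// orlicz_chord.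
have hasub : has_ubound S by exists ((phi (s+1) - phi s) / (s+1 - s)); apply: ubS; lra.
have S0 : S ((phi s - phi 0) / (s - 0)) by exists 0; rewrite ?lexx.
exists (sup S).
  apply: lt_le_trans (ub_le_sup hasub S0).
  by rewrite divr_gt0 ?subr_gt0// ?orlicz_lt.
move=> t t0; have [ts|st|->] := ltgtP t s; last by rewrite subrr; lra.
  have : S ((phi s - phi t) / (s - t)) by exists t => //; rewrite t0.
  move=> /(ub_le_sup hasub); rewrite ler_pdivrMr ?subr_gt0//; lra.
have := ge_sup (ex_intro _ _ S0) (ubS _ st).
rewrite ler_pdivlMr ?subr_gt0//; lra.
Qed.

(** The intermediate value theorem along the ray through [(A, B)], between the
origin and the first point with a coordinate equal to 1; there both arguments
of [phi] stay in [[0, 1]], where [phi] is Lipschitz. *)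
Lemma orlicz_level (A B : R) : 0 < A -> 0 < B ->
  exists x, [/\ 0 < x & phi (A * x) + phi (B * x) = 1].
Proof.
move=> A0 B0.
wlog AB : A B A0 B0 / B <= A.
  move=> H; have [/H|/ltW/H] := leP B A; first exact.
  by case=> // x [x0 h]; exists x; split=> //; rewrite addrC.
pose g x := phi (A * x) + phi (B * x).
have itv x : x \in `[0, A^-1] -> [/\ 0 <= A * x, A * x <= 1, 0 <= B * x & B * x <= 1].
  rewrite in_itv/= => /andP[x0 xA].
  have Ax : A * x <= 1 by rewrite mulrC -ler_pdivlMr// mul1r.
  by split=> //; nra.
have glip x y : x \in `[0, A^-1] -> y \in `[0, A^-1] ->
    `|g x - g y| <= phi 2 * (A + B) * `|x - y|.
  wlog xy : x y / y <= x.
    move=> H hx hy; have [yx|/ltW xy] := leP y x; first exact: H.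
    by rewrite distrC (distrC x); exact: H.
  move=> /itv[a1 a2 b1 b2] /itv[c1 c2 d1 d2].
  have Ay : A * y <= A * x by rewrite ler_pM2l.
  have By : B * y <= B * x by rewrite ler_pM2l.
  have := orlicz_lipschitz _ _ c1 Ay a2; have := orlicz_lipschitz _ _ d1 By b2.
  have := orlicz_le _ _ c1 Ay; have := orlicz_le _ _ d1 By => h1 h2 h3 h4.
  rewrite /g !ger0_norm ?subr_ge0//; last by rewrite lerD.
  by rewrite -mulrBr in h3; rewrite -mulrBr in h4; lra.
have gcont : {within `[0, A^-1], continuous g}.
  apply/subspace_continuousP => x /= hx.
  apply/cvgrPdist_le => e e0.
  have k0 : 0 < phi 2 * (A + B) + 1.
    by rewrite ltr_wpDl// mulr_ge0 ?orlicz_ge0// addr_ge0// ltW.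
  rewrite near_withinE; near=> y => hy.
  apply: le_trans (glip _ _ hx hy) _.
  have h : `|x - y| <= e / (phi 2 * (A + B) + 1).
    near: y; apply: cvgr_dist_le; [exact: cvg_id | exact: divr_gt0].
  rewrite ler_pdivlMr// in h; have := normr_ge0 (x - y); lra.
have g0 : g 0 = 0 by rewrite /g !mulr0 orlicz0 addr0.
have Ai : 0 <= A^-1 by rewrite invr_ge0 ltW.
have g1 : 1 <= g A^-1.
  rewrite /g divff ?gt_eqF// orlicz1 lerDl orlicz_ge0//.
  by apply: mulr_ge0 => //; exact: ltW.
have [] := @IVT R g 0 A^-1 1 Ai gcont.
  by rewrite g0 ge_min ler01 /= le_max g1 orbT.
move=> x; rewrite in_itv/= => /andP[x0 _] gx; exists x; split=> //.
rewrite lt_def x0 andbT; apply/eqP => xE; move: gx; rewrite xE g0 => /eqP.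
by rewrite eq_sym oner_eq0.
Unshelve. all: by end_near. Qed.

Lemma orlicz_gauge_le (A B l : R) : 0 < l -> phi (A / l) + phi (B / l) <= 1 ->
  orlicz_gauge phi A B <= l.
Proof. by move=> l0 h; apply: ge_inf => //; exists 0 => r [/ltW]. Qed.

Lemma orlicz_gauge_ge (A B m : R) : 0 <= A -> 0 <= B ->
  (forall l, 0 < l -> phi (A / l) + phi (B / l) <= 1 -> m <= l) ->
  m <= orlicz_gauge phi A B.
Proof.
move=> A0 B0 h; apply: lb_le_inf; last by move=> l [l0 hl]; exact: h.
have l0 : 0 < A + B + 1 by lra.
(* Since [phi t <= t] on [[0, 1]], any [l >= A + B] is admissible; the 1
   keeps it positive when [A = B = 0]. *)
exists (A + B + 1); split=> //.
have hA : phi (A / (A + B + 1)) <= A / (A + B + 1).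
  by apply: orlicz_le_id; rewrite divr_ge0 ?(ltW l0)//= ler_pdivrMr//; lra.
have hB : phi (B / (A + B + 1)) <= B / (A + B + 1).
  by apply: orlicz_le_id; rewrite divr_ge0 ?(ltW l0)//= ler_pdivrMr//; lra.
apply: le_trans (lerD hA hB) _.
by rewrite -mulrDl ler_pdivrMr//; lra.
Qed.

Lemma orlicz_gaugeC (A B : R) : orlicz_gauge phi A B = orlicz_gauge phi B A.
Proof.
by rewrite /orlicz_gauge; congr inf; apply/seteqP; split=> l [l0 h];
  split=> //; rewrite addrC.
Qed.

Lemma orlicz_gauge_ge_l (A B : R) : 0 <= A -> 0 <= B -> A <= orlicz_gauge phi A B.
Proof.
move=> A0 B0; apply: orlicz_gauge_ge => // l l0 h.
have Al : 0 <= A / l by rewrite divr_ge0// ltW.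
have Bl : 0 <= B / l by rewrite divr_ge0// ltW.
have := orlicz_le1 _ Al; rewrite ler_pdivrMr// mul1r; apply.
by have := orlicz_ge0 _ Bl; lra.
Qed.

Lemma orlicz_gauge_ge_r (A B : R) : 0 <= A -> 0 <= B -> B <= orlicz_gauge phi A B.
Proof. by move=> A0 B0; rewrite orlicz_gaugeC orlicz_gauge_ge_l. Qed.

(** At [A = B = 0] every positive number is admissible, so that the infimum is
not attained. *)
Lemma orlicz_gauge_A0 (A : R) : 0 <= A -> orlicz_gauge phi A 0 <= A.
Proof.
rewrite le_eqVlt => /predU1P[<-|A0].
  apply/ler_addgt0Pl => e e0; rewrite addr0; apply: orlicz_gauge_le => //.
  by rewrite !mul0r orlicz0 addr0.
by apply: orlicz_gauge_le => //; rewrite divff ?gt_eqF// mul0r orlicz0 orlicz1 addr0.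
Qed.

(** The gauge is the pointwise maximum of the linear functions below it.  For
[A, B > 0] let [(s, t) = (A x, B x)] be the point of the level curve on the ray of
[(A, B)], and [p], [q] subgradients of [phi] at [s] and [t].  The sublevel set
[phi s' + phi t' <= 1] lies in the half-plane [p s' + q t' <= N], with
[N = p s + q t], so [(a, b) = (p, q) / N] works.  On the axes a coordinate
function does. *)
Lemma orlicz_gauge_dual (A B : R) : 0 <= A -> 0 <= B ->
  exists a b, [/\ 0 <= a, 0 <= b, orlicz_gauge phi A B <= a * A + b * B &
    forall A' B', 0 <= A' -> 0 <= B' ->
      a * A' + b * B' <= orlicz_gauge phi A' B'].
Proof.
rewrite le_eqVlt => /predU1P[<-|A0].
  move=> B0; exists 0, 1; split => //.
    by rewrite orlicz_gaugeC mul0r add0r mul1r orlicz_gauge_A0.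
  by move=> ? ? ? ?; rewrite mul0r add0r mul1r orlicz_gauge_ge_r.
rewrite le_eqVlt => /predU1P[<-|B0].
  exists 1, 0; split => //; first by rewrite mul0r addr0 mul1r orlicz_gauge_A0// ltW.
  by move=> ? ? ? ?; rewrite mul0r addr0 mul1r orlicz_gauge_ge_l.
have [x [x0 level]] := orlicz_level _ _ A0 B0.
have [p p0 hp] := orlicz_subgradient (A * x) (mulr_gt0 A0 x0).
have [q q0 hq] := orlicz_subgradient (B * x) (mulr_gt0 B0 x0).
have N0 : 0 < p * (A * x) + q * (B * x) by rewrite addr_gt0// !mulr_gt0.
set N := p * _ + _ in N0.
exists (p / N), (q / N); split; [exact/divr_ge0/ltW/N0/ltW|exact/divr_ge0/ltW/N0/ltW| |].
  have -> : p / N * A + q / N * B = x^-1.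
    apply: (mulIf (lt0r_neq0 x0)); rewrite mulVf ?gt_eqF//.
    by rewrite /N; field; rewrite gt_eqF.
  by apply: orlicz_gauge_le; rewrite ?invr_gt0// invrK level.
move=> A' B' A'0 B'0; apply: orlicz_gauge_ge => // l l0 h.
have := hp (A' / l) (divr_ge0 A'0 (ltW l0)).
have := hq (B' / l) (divr_ge0 B'0 (ltW l0)) => hB hA.
have : p * (A' / l) + q * (B' / l) <= N by rewrite /N; lra.
rewrite !mulrA -mulrDl ler_pdivrMr// => h'.
by rewrite mulrAC (mulrAC q) -mulrDl ler_pdivrMr// (mulrC l).
Qed.

End OrliczFunction.

(** * Support functions and existence of the Orlicz sum *)

Section Dot.
Context {R : realType} {n : nat}.
Implicit Types (x y u : 'rV[R]_n).

Lemma dotC x y : dot x y = dot y x.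
Proof. by apply: eq_bigr => k _; rewrite mulrC. Qed.

Lemma dotDr u x y : dot u (x + y) = dot u x + dot u y.
Proof. by rewrite -big_split; apply: eq_bigr => k _; rewrite mxE mulrDr. Qed.

Lemma dotZr u (a : R) x : dot u (a *: x) = a * dot u x.
Proof. by rewrite mulr_sumr; apply: eq_bigr => k _; rewrite mxE mulrCA. Qed.

Lemma dotNr u x : dot u (- x) = - dot u x.
Proof. by rewrite -scaleN1r dotZr mulN1r. Qed.

Lemma dotNl u x : dot (- u) x = - dot u x.
Proof. by rewrite dotC dotNr dotC. Qed.

Lemma dot0r u : dot u 0 = 0.
Proof. by rewrite -(scale0r 0) dotZr mul0r. Qed.

Lemma dot_delta u (k : 'I_n) : dot u 'e_k = u 0 k.
Proof.
rewrite /dot (bigD1 k)//= big1 ?addr0 => [|j jk]; first by rewrite mxE !eqxx mulr1.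
by rewrite mxE (negbTE jk) andbF mulr0.
Qed.

Lemma dot_ge0 x : 0 <= dot x x.
Proof. by apply: sumr_ge0 => k _; rewrite -expr2 sqr_ge0. Qed.

Lemma dot_eq0 x : dot x x = 0 -> x = 0.
Proof.
move=> h; apply/rowP => k; rewrite mxE; apply/eqP.
rewrite -sqrf_eq0; apply/eqP.
move: h; rewrite /dot => /eqP; rewrite psumr_eq0 => [/allP/(_ k)|j _]; last first.
  by rewrite -expr2 sqr_ge0.
by rewrite mem_index_enum /= -expr2 => /(_ isT)/eqP.
Qed.

Lemma dot_continuous u : continuous (dot u).
Proof.
rewrite /dot; apply: continuous_big; first exact: add_continuous.
move=> k _ x.
apply: (@continuous_comp _ _ _ (fun y : 'rV[R]_n => y ord0 k) ( *%R (u ord0 k))).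
  exact: coord_continuous.
exact: mulrl_continuous.
Qed.

Lemma dot_conv u x y (t : {i01 R}) : dot u (conv t (x : convex_lmodType _) y) =
  t%:num * dot u x + (1 - t%:num) * dot u y.
Proof. by rewrite dotDr !dotZr. Qed.

Lemma compact_support_max (K : set 'rV[R]_n) u : compact K -> K !=set0 ->
  exists2 x, K x & forall y, K y -> dot u y <= dot u x.
Proof.
move=> cK K0; have [x] := @EVT_max_rV R n (dot u) K K0 cK
  (continuous_subspaceT (dot_continuous u)).
rewrite inE => Kx h; exists x => // y Ky; apply: h; exact/mem_set.
Qed.

Lemma dot_le_support (K : set 'rV[R]_n) u y : compact K -> K y ->
  dot u y <= support_function K u.
Proof.
move=> cK Ky; have [x Kx h] := compact_support_max _ u cK (ex_intro _ _ Ky).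
apply: ub_le_sup; last by exists y.
by exists (dot u x) => _ [z Kz <-]; exact: h.
Qed.

Lemma support_le (K : set 'rV[R]_n) u (c : R) : K !=set0 ->
  (forall y, K y -> dot u y <= c) -> support_function K u <= c.
Proof.
move=> [x Kx] h; apply: ge_sup; first by exists (dot u x), x.
by move=> _ [y Ky <-]; exact: h.
Qed.

Lemma support_attained (K : set 'rV[R]_n) u : compact K -> K !=set0 ->
  exists2 x, K x & support_function K u = dot u x.
Proof.
move=> cK K0; have [x Kx h] := compact_support_max _ u cK K0; exists x => //.
by apply/eqP; rewrite eq_le support_le//= dot_le_support.
Qed.

Lemma support_ge0 (K : set 'rV[R]_n) u : convex_body_o K -> 0 <= support_function K u.
Proof. by move=> [[_ cK _] K0]; rewrite -(dot0r u) dot_le_support. Qed.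

Definition wulff_shape (h : 'rV[R]_n -> R) : set 'rV[R]_n :=
  [set y | forall u, dot u y <= h u].

Lemma wulff_convex h : convex_set (wulff_shape h).
Proof.
move=> x y t; rewrite !inE => hx hy u; rewrite dot_conv.
have t0 : 0 <= t%:num by [].
have t1 : 0 <= 1 - t%:num by rewrite subr_ge0.
have -> : h u = t%:num * h u + (1 - t%:num) * h u by rewrite -mulrDl addrC subrK mul1r.
by rewrite lerD// ler_wpM2l.
Qed.

(** The half-spaces for the vectors [+-'e_k] already confine the shape to a
product of segments. *)
Lemma wulff_compact h : compact (wulff_shape h).
Proof.
apply: (@subclosed_compact _ _ [set y : 'rV[R]_n |
    forall k, `[- h (- 'e_k), h 'e_k]%classic (y ord0 k)]).
- have -> : wulff_shape h = \bigcap_u [set y | dot u y <= h u].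
    by apply/seteqP; split=> [y hy u _|y hy u]; [exact: hy|exact: hy].
  apply: closed_bigI => u _.
  have /continuous_closedP/(_ [set r | r <= h u]) := dot_continuous u; apply.
  exact: closed_le.
- have := @rV_compact R n (fun k => `[- h (- 'e_k), h 'e_k]%classic).
  by apply=> k; exact: segment_compact.
- move=> y hy k; rewrite /= in_itv/= lerNl.
  by rewrite -dot_delta dotC hy -dotNl hy.
Qed.

Section OrliczSum.
Context {phi : R -> R}.
Hypothesis hphi : orlicz_class phi.
Context {K L : set 'rV[R]_n}.
Hypotheses (hK : convex_body_o K) (hL : convex_body_o L).

Lemma orlicz_support_ge_l u : support_function K u <= orlicz_support phi K L u.
Proof. exact: (orlicz_gauge_ge_l hphi _ _ (support_ge0 _ _ hK) (support_ge0 _ _ hL)). Qed.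

Lemma orlicz_support_ge_r u : support_function L u <= orlicz_support phi K L u.
Proof. exact: (orlicz_gauge_ge_r hphi _ _ (support_ge0 _ _ hK) (support_ge0 _ _ hL)). Qed.

Lemma wulff_orlicz_body : convex_body (wulff_shape (orlicz_support phi K L)).
Proof.
split; [exact: wulff_convex|exact: wulff_compact|].
case: (hK) => -[_ cK [x Kx]] _; exists x; apply: interiorS Kx => y Ky u.
exact: le_trans (dot_le_support _ u _ cK Ky) (orlicz_support_ge_l u).
Qed.

(** A Wulff shape may have a support function smaller than the function that
defines it.  Here it does not: for each [u], the linear function touching the gauge at
[(h_K u, h_L u)] gives a point [a x + b y] of the shape with
[dot u (a x + b y)] at least the gauge. *)
Lemma wulff_orlicz_support :
  support_function (wulff_shape (orlicz_support phi K L)) = orlicz_support phi K L.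
Proof.
have [_ cM [x0 /interior_subset Mx0]] := wulff_orlicz_body.
apply/funext => u; apply/eqP; rewrite eq_le; apply/andP; split.
  by apply: support_le; [exists x0|move=> y; apply].
have [a [b [a0 b0 hab hsub]]] := orlicz_gauge_dual hphi _ _
  (support_ge0 _ u hK) (support_ge0 _ u hL).
case: (hK) => -[_ cK _] K0; case: (hL) => -[_ cL _] L0.
have [x Kx hx] := support_attained _ u cK (ex_intro _ _ K0).
have [y Ly hy] := support_attained _ u cL (ex_intro _ _ L0).
apply: le_trans hab _; rewrite hx hy -!dotZr -dotDr.
apply: dot_le_support => // v; rewrite dotDr !dotZr.
apply: le_trans (hsub _ _ (support_ge0 _ v hK) (support_ge0 _ v hL)).
by rewrite lerD// ler_wpM2l// dot_le_support.
Qed.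

Lemma orlicz_sumP : convex_body (orlicz_sum phi K L) /\
  support_function (orlicz_sum phi K L) = orlicz_support phi K L.
Proof.
rewrite /orlicz_sum; case: xgetP => [M _ //|/(_ (wulff_shape (orlicz_support phi K L)))].
by case; split; [exact: wulff_orlicz_body|exact: wulff_orlicz_support].
Qed.

End OrliczSum.
End Dot.

(** * Coordinate subspaces and orthogonal projections *)

Section Subspaces.
Context {R : realType} {n : nat}.
Implicit Types (x y u : 'rV[R]_n) (L : {vspace 'rV[R]_n}) (J : {set 'I_n}).

Definition coord_subspace J : {vspace 'rV[R]_n} :=
  <<[seq 'e_k | k <- enum J]>>%VS.

Lemma free_deltas : free [seq ('e_k : 'rV[R]_n) | k <- enum 'I_n].
Proof.
rewrite /free size_map size_enum_ord.
have -> : <<[seq ('e_k : 'rV[R]_n) | k <- enum 'I_n]>>%VS = fullv; last first.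
  rewrite dimvf dim_matrix; apply/eqP; exact: mul1n.
apply/vspaceP => x; rewrite memvf.
rewrite (row_sum_delta x); apply: memv_suml => k _; apply: memvZ.
by apply: memv_span; apply: map_f; rewrite mem_enum.
Qed.

Lemma dim_coord_subspace J : \dim (coord_subspace J) = #|J|.
Proof.
have : free ([seq ('e_k : 'rV[R]_n) | k <- enum J] ++ [seq 'e_k | k <- enum (~: J)]).
  rewrite (perm_free (Y := [seq 'e_k | k <- enum 'I_n])) ?free_deltas//.
  rewrite -map_cat; apply: perm_map; apply: uniq_perm; last first.
  - by move=> k; rewrite mem_cat !mem_enum inE orbN.
  - exact: enum_uniq.
  rewrite cat_uniq !enum_uniq andbT/=; apply/hasPn => k /=.
  by rewrite !mem_enum inE.
by move/catl_free; rewrite /free size_map -cardE => /eqP.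
Qed.

Lemma delta_coord_subspace J (k : 'I_n) : k \in J -> 'e_k \in coord_subspace J.
Proof. by move=> kJ; apply/memv_span/map_f; rewrite mem_enum. Qed.

Lemma coord_subspace_eq0 J x k : x \in coord_subspace J -> k \notin J -> x 0 k = 0.
Proof.
move=> xJ kJ; move: x xJ.
pose f : 'Hom('rV[R]_n, 'rV[R]_1) := linfun (mulmxr (delta_mx k 0)).
have fE x : f x 0 0 = x 0 k.
  rewrite lfunE/= mxE (bigD1 k)//= big1 ?addr0 => [|j jk]; first by rewrite mxE !eqxx mulr1.
  by rewrite mxE (negbTE jk) mulr0.
suff /subvP h : (coord_subspace J <= lker f)%VS.
  by move=> x /h; rewrite memv_ker => /eqP fx; rewrite -fE fx mxE.
apply/span_subvP => _ /mapP[j jJ ->]; rewrite memv_ker; apply/eqP/rowP => z.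
rewrite ord1 fE !mxE eqxx /=; case: eqP => // jk.
by move: kJ; rewrite jk -mem_enum jJ.
Qed.

(** The products with a basis of [L] define a linear map that is injective on
[L], since a vector of [L] orthogonal to [L] is zero; hence it maps [L] onto its
whole range, and [x] has the same image as some [y] in [L]. *)
Lemma projection_exists L x :
  exists2 y, y \in L & forall z, z \in L -> dot (x - y) z = 0.
Proof.
pose B : 'M[R]_(n, \dim L) := \matrix_(k, j) (vbasis L)`_j 0 k.
pose f : 'Hom('rV[R]_n, 'rV[R]_(\dim L)) := linfun (mulmxr B).
have fE v j : f v 0 j = dot v (vbasis L)`_j.
  by rewrite lfunE/= mxE; apply: eq_bigr => k _; rewrite mxE.
have f0 v z : f v = 0 -> z \in L -> dot v z = 0.
  move=> fv /coord_vbasis->; rewrite (big_morph (dot v) (dotDr v) (dot0r v)).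
  by apply: big1 => j _; rewrite dotZr -fE fv mxE mulr0.
have kerf : (L :&: lker f = 0)%VS.
  apply/eqP; rewrite -subv0; apply/subvP => v.
  rewrite memv_cap memv_ker memv0 => /andP[vL /eqP fv].
  by apply/eqP/dot_eq0/f0.
have imf : (f @: L = fullv)%VS.
  apply/eqP; rewrite eqEdim subvf (limg_dim_eq kerf).
  by rewrite dimvf dim_matrix [X in (X <= _)%N]mul1n leqnn.
have /memv_imgP[y yL fxy] : f x \in (f @: L)%VS by rewrite imf memvf.
exists y => // z zL; apply: f0 zL.
by rewrite linearB/= fxy subrr.
Qed.

End Subspaces.

(** * Bounds on the outer radii *)

Section Radii.
Context {R : realType} {n : nat}.
Implicit Types (x y u : 'rV[R]_n) (L : {vspace 'rV[R]_n}) (J : {set 'I_n}).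

Lemma euclidean_norm_ge0 x : 0 <= euclidean_norm x.
Proof. exact: sqrtr_ge0. Qed.

Lemma sqr_euclidean_norm x : euclidean_norm x ^+ 2 = dot x x.
Proof. by rewrite sqr_sqrtr// dot_ge0. Qed.

Lemma euclidean_norm_le (e : R) x : 0 <= e -> (forall k, `|x 0 k| <= e) ->
  euclidean_norm x <= n%:R * e.
Proof.
move=> e0 h; have ne0 : 0 <= n%:R * e by rewrite mulr_ge0.
rewrite -ler_sqr ?nnegrE ?euclidean_norm_ge0// sqr_euclidean_norm.
apply: (@le_trans _ _ (n%:R * e ^+ 2)).
  rewrite -[n in n%:R]card_ord mulr_natl -sumr_const; apply: ler_sum => k _.
  by rewrite -expr2 -[_ ^+ 2]real_normK ?num_real// ler_sqr ?nnegrE.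
rewrite exprMn ler_wpM2r ?sqr_ge0// -natrX ler_nat.
by case: (n) => // m; rewrite leq_pmulr.
Qed.

Lemma circumradius_le (A : set 'rV[R]_n) (r : R) (p : 'rV[R]_n) : 0 <= r ->
  (forall x, A x -> euclidean_norm (x - p) <= r) -> circumradius A <= r.
Proof.
move=> r0 h; apply: ge_inf; first by exists 0 => s [].
by split=> //; exists p.
Qed.

Lemma circumradius_ge0 (A : set 'rV[R]_n) : 0 <= circumradius A.
Proof.
rewrite /circumradius; set S := [set _ | _].
have [S0|/set0P/negP/negPn/eqP->] := pselect (S !=set0); last by rewrite inf0.
by apply: lb_le_inf => // s [].
Qed.

Lemma outer_radius_le (K : set 'rV[R]_n) L :
  outer_radius (\dim L) K <= circumradius (orthogonal_projection K L).
Proof.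
apply: ge_inf; last by exists L.
by exists 0 => _ [L' _ ->]; exact: circumradius_ge0.
Qed.

Lemma outer_radius_ge (K : set 'rV[R]_n) J (r : R) :
  (forall L, \dim L = #|J| -> r <= circumradius (orthogonal_projection K L)) ->
  r <= outer_radius #|J| K.
Proof.
move=> h; apply: lb_le_inf; last by move=> _ [L dL ->]; exact: h.
exists (circumradius (orthogonal_projection K (coord_subspace J))).
by exists (coord_subspace J) => //; rewrite dim_coord_subspace.
Qed.

Lemma cauchy_schwarz x y : dot x y <= euclidean_norm x * euclidean_norm y.
Proof.
set a := euclidean_norm x; set b := euclidean_norm y.
have a0 : 0 <= a := euclidean_norm_ge0 x; have b0 : 0 <= b := euclidean_norm_ge0 y.
have [ab|ab] := ltP 0 (a * b); last first.
  have /eqP : a * b = 0 by apply/eqP; rewrite eq_le ab mulr_ge0.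
  rewrite mulf_eq0 => /orP[] /eqP h; rewrite h ?(mul0r, mulr0).
    by rewrite (dot_eq0 x) -?sqr_euclidean_norm -/a ?h ?expr0n// dotC dot0r.
  by rewrite (dot_eq0 y) -?sqr_euclidean_norm -/b ?h ?expr0n// dot0r.
have := dot_ge0 (b *: x - a *: y).
rewrite dotDr dotNr !dotZr !(dotC (_ - _)) !dotDr !dotNr !dotZr (dotC y x).
rewrite -!sqr_euclidean_norm -/a -/b => h.
rewrite -(ler_pM2l ab); nra.
Qed.

Lemma compact_norm_bounded (K : set 'rV[R]_n) : compact K ->
  exists2 r, 0 <= r & forall x, K x -> euclidean_norm x <= r.
Proof.
move=> cK; have [K0|/nonemptyPn->] := pselect (K !=set0); last by exists 0.
have cont : continuous (fun x : 'rV[R]_n => dot x x).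
  rewrite /dot; apply: continuous_big; first exact: add_continuous.
  have ck (k : 'I_n) : continuous (fun x : 'rV[R]_n => x ord0 k) by exact: coord_continuous.
  by move=> k _ x; apply: (continuousM (ck k x) (ck k x)).
have [x _ h] := @EVT_max_rV R n _ K K0 cK (continuous_subspaceT cont).
exists (euclidean_norm x) => // [|y Ky]; first exact: euclidean_norm_ge0.
by rewrite ler_sqrt ?dot_ge0// h// inE.
Qed.

(** For [u] in [L], a point and its projection onto [L] have the same product
with [u]; a ball of radius [r] has width [2 r] in every direction. *)
Lemma width_le_circumradius (M : set 'rV[R]_n) L u : compact M -> M !=set0 ->
  u \in L ->
  support_function M u + support_function M (- u) <=
    2 * euclidean_norm u * circumradius (orthogonal_projection M L).
Proof.
move=> cM M0 uL.
have [u0|u0] := ltP 0 (euclidean_norm u); last first.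
  have nu : euclidean_norm u = 0 by apply/eqP; rewrite eq_le u0 euclidean_norm_ge0.
  have -> : u = 0 by apply: dot_eq0; rewrite -sqr_euclidean_norm nu expr0n.
  have h0 : support_function M 0 <= 0.
    by apply: support_le => // y _; rewrite dotC dot0r.
  rewrite oppr0; apply: le_trans (lerD h0 h0) _.
  by rewrite addr0 !mulr_ge0 ?euclidean_norm_ge0 ?circumradius_ge0.
have u20 : 0 < 2 * euclidean_norm u by rewrite mulr_gt0.
rewrite -ler_pdivrMl//; apply: lb_le_inf.
  (* The infimum of an empty set would be 0: some ball does contain the
     projection, because projecting does not increase norms. *)
  have [r r0 hr] := compact_norm_bounded _ cM.
  exists r; split=> //; exists 0 => y [yL [x Mx hxy]]; rewrite subr0.
  have [y0|y0] := ltP 0 (euclidean_norm y); last exact: le_trans y0 r0.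
  have yy : dot y y = dot x y.
    by have := hxy y yL; rewrite dotC dotDr dotNr (dotC y x) => /subr0_eq.
  apply: le_trans (hr _ Mx); rewrite -(ler_pM2r y0) -expr2 sqr_euclidean_norm yy.
  exact: cauchy_schwarz.
move=> r [r0 [p hp]].
have half v : v \in L -> support_function M v <= dot v p + euclidean_norm v * r.
  move=> vL; apply: support_le => // x Mx.
  have [y yL hxy] := projection_exists L x.
  have vy : dot v x = dot v y.
    by have := hxy v vL; rewrite dotC dotDr dotNr => /subr0_eq.
  rewrite vy -lerBlDl -dotNr -dotDr; apply: le_trans (cauchy_schwarz _ _) _.
  by rewrite ler_wpM2l ?euclidean_norm_ge0// hp//; split=> //; exists x.
have nN : euclidean_norm (- u) = euclidean_norm u.
  by rewrite /euclidean_norm dotNl dotNr opprK.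
have := half u uL; have := half (- u); rewrite memvN => /(_ uL).
rewrite nN dotNl ler_pdivrMl//; lra.
Qed.

(** A body that extends by 1 in every coordinate direction outside [D] cannot
be projected to a small set along fewer dimensions than needed: a subspace [L] of
dimension greater than [#|D|] meets the vectors vanishing on [D], and there the
width of the body controls every coordinate. *)
Lemma outer_radius_ge_coord (M : set 'rV[R]_n) (J D : {set 'I_n}) :
  (0 < n)%N -> (#|D| < #|J|)%N -> compact M -> M !=set0 ->
  (forall u k, k \notin D -> `|u 0 k| <= support_function M u) ->
  n%:R^-1 <= outer_radius #|J| M.
Proof.
move=> n0 DJ cM M0 hM; apply: outer_radius_ge => L dL.
set c := circumradius _.
have : (0 < \dim (L :&: coord_subspace (~: D)))%N.
  have := dimv_sum_cap L (coord_subspace (~: D)).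
  rewrite dL dim_coord_subspace (cardsCs (~: D)) finset.setCK card_ord.
  have := dimvS (subvf (L + coord_subspace (~: D))%VS).
  rewrite dimvf dim_matrix [X in (_ <= X)%N]mul1n.
  have := max_card (mem D); rewrite card_ord.
  lia.
rewrite lt0n dimv_eq0 -vpick0; set u := vpick _ => u0.
have /andP[uL uD] : (u \in L) && (u \in coord_subspace (~: D)).
  by rewrite -memv_cap memv_pick.
have nu0 : 0 < euclidean_norm u.
  rewrite lt_def euclidean_norm_ge0 andbT; apply: contraNneq u0 => h.
  by apply/eqP/dot_eq0; rewrite -sqr_euclidean_norm h expr0n.
have := width_le_circumradius _ _ _ cM M0 uL; rewrite -/c => hw.
have c0 : 0 <= c := circumradius_ge0 _.
have : euclidean_norm u <= n%:R * (euclidean_norm u * c).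
  apply: euclidean_norm_le => [|k]; first by rewrite mulr_ge0// ltW.
  have [kD|kD] := boolP (k \in D).
    rewrite (coord_subspace_eq0 _ _ _ uD) ?inE ?kD// normr0.
    by rewrite mulr_ge0// ltW.
  have := hM u k kD; have := hM (- u) k kD; rewrite mxE normrN; lra.
rewrite mulrCA -[X in X <= _]mulr1 ler_pM2l// => h.
by rewrite -[n%:R^-1]mulr1 ler_pdivrMl// ltr0n.
Qed.

End Radii.

(** * Boxes thin in prescribed coordinates *)

Section Box.
Context {R : realType} {n : nat}.
Implicit Types (x y u : 'rV[R]_n) (J : {set 'I_n}) (e : R).

Definition box J e : set 'rV[R]_n :=
  [set x | forall k, `|x ord0 k| <= if k \in J then e else 1].

Lemma box_body J e : 0 < e -> convex_body_o (box J e).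
Proof.
move=> e0; pose w k : R := if k \in J then e else 1.
have w0 k : 0 < w k by rewrite /w; case: ifP.
have B0 : box J e 0 by move=> k; rewrite mxE normr0 ltW// w0.
split=> //; split.
- move=> x y t; rewrite !inE => hx hy k.
  have t0 : 0 <= t%:num by [].
  have t1 : 0 <= 1 - t%:num by rewrite subr_ge0.
  rewrite !mxE; apply: le_trans (ler_normD _ _) _.
  rewrite !normrM (ger0_norm t0) (ger0_norm t1) -/(w k).
  have -> : w k = t%:num * w k + (1 - t%:num) * w k by rewrite -mulrDl addrC subrK mul1r.
  by rewrite lerD// ler_wpM2l.
- have -> : box J e = [set x | forall k, `[- w k, w k]%classic (x ord0 k)].
    apply/seteqP; split=> x hx k; have := hx k; rewrite /= in_itv/= -/(w k) ler_norml //.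
  have := @rV_compact R n (fun k => `[- w k, w k]%classic).
  by apply=> k; exact: segment_compact.
- exists 0; apply/nbhs_ballP; exists (Num.min e 1); first by rewrite /= lt_min e0 ltr01.
  move=> x [_ /(_ ord0) hx] k; have := hx k.
  rewrite -ball_normE /ball_/= mxE sub0r normrN lt_min => /andP[/ltW h1 /ltW h2].
  by case: ifP.
Qed.

Lemma box_support_ge J e u k : 0 < e -> k \notin J ->
  `|u 0 k| <= support_function (box J e) u.
Proof.
move=> e0 kJ; have [[_ cB _] _] := box_body J _ e0.
rewrite normrEsg -dot_delta -dotZr; apply: dot_le_support => // j.
rewrite !mxE eqxx/=; have [->|jk] := eqVneq j k.
  by rewrite (negbTE kJ) mulr1 normr_sg lern1 leq_b1.
by rewrite mulr0 normr0; case: ifP => // _; exact: ltW.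
Qed.

Lemma outer_radius_box J e : 0 < e -> outer_radius #|J| (box J e) <= n%:R * e.
Proof.
move=> e0; rewrite -(@dim_coord_subspace R).
apply: le_trans (outer_radius_le _ _) _.
apply: (circumradius_le _ _ 0) => [|y [yJ [x hx xy]]].
  by rewrite mulr_ge0// ltW.
rewrite subr0; apply: euclidean_norm_le => [|k]; first exact: ltW.
have [kJ|kJ] := boolP (k \in J); last first.
  by rewrite (coord_subspace_eq0 _ _ _ yJ kJ) normr0 ltW.
have := xy _ (delta_coord_subspace _ _ kJ).
rewrite dot_delta !mxE => /subr0_eq <-.
by have := hx k; rewrite kJ.
Qed.

End Box.

(** * Two thin boxes with a thick sum *)

Lemma exchange_sets (n i : nat) : (1 <= i <= n.-1)%N ->
  exists J J' : {set 'I_n}, [/\ #|J| = i, #|J'| = i & (#|J :&: J'| < i)%N].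
Proof.
move=> /andP[i1 iN]; have i_lt_n : (i < n)%N by lia.
have : (0 < #|[set A : {set 'I_n} | #|A| == i]%SET|)%N.
  by rewrite card_draws card_ord bin_gt0 ltnW.
case/card_gt0P => J; rewrite inE => /eqP cJ.
have [a aJ] : exists a, a \in J by apply/card_gt0P; rewrite cJ.
have [b] : exists b, b \in ~: J.
  by apply/card_gt0P; rewrite (cardsCs (~: J)) finset.setCK card_ord cJ subn_gt0.
rewrite inE => bJ; exists J, (b |: J :\ a); split=> //.
  by rewrite cardsU1 !inE (negbTE bJ) andbF/=; have := cardsD1 a J; rewrite aJ cJ => ->.
have sub : J :&: (b |: J :\ a) \subset J :\ a.
  apply/fintype.subsetP => k; rewrite !inE => /andP[kJ /orP[/eqP kb|//]].
  by move: bJ; rewrite -kb kJ.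
apply: leq_ltn_trans (subset_leq_card sub) _.
by have := cardsD1 a J; rewrite aJ cJ => ->.
Qed.

Theorem proposition0p2 (R : realType) (n : nat) (phi : R -> R)
    (hphi : orlicz_class phi) (i : nat) (hi : (1 <= i <= n.-1)%N) :
  ~ exists2 c : R, 0 < c &
      forall K K' : set 'rV[R]_n, convex_body_o K -> convex_body_o K' ->
        c * outer_radius i (orlicz_sum phi K K') <=
          outer_radius i K + outer_radius i K'.
Proof.
case=> c c0 hc.
have n0 : (0 < n)%N by lia.
have N0 : 0 < n%:R :> R by rewrite ltr0n.
have [J [J' [cJ cJ' cD]]] := exchange_sets _ _ hi.
(* The boxes have radii at most [n e], so this makes their sum [c / (2 n)],
   below the lower bound [c / n] for the left-hand side. *)
pose e : R := c / (4 * n%:R ^+ 2).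
have e0 : 0 < e by rewrite divr_gt0// mulr_gt0// exprn_gt0.
have bK := box_body J _ e0; have bK' := box_body J' _ e0.
have [[_ cM [x /interior_subset Mx]] hM] := orlicz_sumP hphi bK bK'.
have low : n%:R^-1 <= outer_radius i (orlicz_sum phi (box J e) (box J' e)).
  rewrite -cJ; apply: (outer_radius_ge_coord _ _ (J :&: J')) => //.
  - by rewrite cJ.
  - by exists x.
  move=> u k; rewrite inE negb_and hM => /orP[kJ|kJ].
    exact: le_trans (box_support_ge _ _ _ _ e0 kJ) (orlicz_support_ge_l hphi bK bK' u).
  exact: le_trans (box_support_ge _ _ _ _ e0 kJ) (orlicz_support_ge_r hphi bK bK' u).
have := hc _ _ bK bK'.
have := outer_radius_box J _ e0; have := outer_radius_box J' _ e0.
rewrite cJ cJ' => h1 h2 h3.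
have ne : n%:R * e = c / n%:R / 4 by rewrite /e; field; rewrite gt_eqF.
have : c / n%:R <= c * outer_radius i (orlicz_sum phi (box J e) (box J' e)).
  by rewrite ler_pM2l.
have : 0 < c / n%:R by rewrite divr_gt0.
rewrite ne in h1 h2; lra.
Qed.
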